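(* Let $U$ be a unitary operator in a Hilbert space $\mathcal H$ and let $A$ be a self-adjoint operator in $\mathcal H$ with domain $\mathcal D(A)$ and with $U\in C^1(A)$. Assume that the strong limit $$D=\mathop{\mathrm{s\text{-}lim}}_{N\to\infty}\frac1N\big[A,U^N\big]U^{-N}$$ exists and satisfies $D\in C^1(A)$. Then, for each $N\in\mathbb N^*$, the operator $$A_{D,N}\varphi:=\frac1N\sum_{n=0}^{N-1}U^nA_DU^{-n}\varphi,\quad\varphi\in\mathcal D(A_{D,N}):=\mathcal D(A_D),$$ is self-adjoint in $\mathcal H$, and $\mathcal D(A)$ is a core for $A_{D,N}$.
   Context: The scalar product $\langle\cdot,\cdot\rangle$ of $\mathcal H$ is antilinear in the first argument, $\mathscr B(\mathcal H)$ is the set of bounded operators on $\mathcal H$, $\mathbb N^*=\{1,2,\dots\}$. For $S\in\mathscr B(\mathcal H)$ one writes $S\in C^1(A)$ if $\mathbb R\ni t\mapsto e^{-itA}Se^{itA}\in\mathscr B(\mathcal H)$ is strongly of class $C^1$, equivalently if the quadratic form $\mathcal D(A)\ni\varphi\mapsto\langle\varphi,SA\varphi\rangle-\langle A\varphi,S\varphi\rangle$ is continuous for the topology induced by $\mathcal H$ on $\mathcal D(A)$; $[S,A]$ denotes the bounded operator associated with its continuous extension, and $[A,S]:=-[S,A]$. If $U\in C^1(A)$ is unitary, then $U^N\in C^1(A)$ for all $N\in\mathbb Z$. $A_D$ denotes the closure of the operator $\varphi\mapsto(AD+DA)\varphi$, $\varphi\in\mathcal D(A)$. ($D$ is bounded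 and self-adjoint; since $D\in C^1(A)$, the operator $\varphi\mapsto(AD+DA)\varphi$ on $\mathcal D(A)$ is essentially self-adjoint, and $\mathcal D(A_D)=\{\varphi\in\mathcal H: D\varphi\in\mathcal D(A)\}$.) *)

(* Defs.v *)
From HB Require Import structures.
From mathcomp Require Import all_boot all_order all_algebra complex.
From mathcomp Require Import all_classical all_reals all_analysis.
Set Implicit Arguments.
Unset Strict Implicit.
Unset Printing Implicit Defensive.
Import Order.TTheory GRing.Theory Num.Theory.
Import numFieldNormedType.Exports.
Local Open Scope classical_set_scope.
Local Open Scope ring_scope.
Local Open Scope complex_scope.

(* The library's positive definite hermitian forms are linear in the first
   argument and antilinear in the second one; see [inner] below. *)
HB.mixin Record CompleteNormedModule_isHilbert (R : realType) H
    of CompleteNormedModule R[i] H := {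
  hform : {dot H for @Num.conj R[i]};
  hform_norm : forall x : H, `|x| ^+ 2 = hform x x
}.

#[short(type="hilbertType")]
HB.structure Definition Hilbert (R : realType) :=
  {H of CompleteNormedModule R[i] H & CompleteNormedModule_isHilbert R H}.

Section HilbertSpaceOperators.
Variables (R : realType) (H : hilbertType R).

(* Scalar product, antilinear in the first argument. *)
Definition inner (x y : H) : R[i] := hform y x.

Local Notation "<[ x , y ]>" := (inner x y).

Definition bounded_operator (S : H -> H) : Prop := linear S /\ continuous S.

Definition unitary (U : H -> H) : Prop :=
  [/\ linear U, forall x y, <[U x, U y]> = <[x, y]> & range U = setT].

Definition op_inv (U : H -> H) : H -> H := 'pinv_(fun _ => 0) setT U.

(* Unbounded operators are given by their graphs. *)
Definition graph_dom (G : set (H * H)) : set H := [set x | exists y, G (x, y)].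

Definition linear_operator (G : set (H * H)) : Prop :=
  [/\ G (0, 0),
      forall (a : R[i]) x y x' y', G (x, y) -> G (x', y') ->
        G (a *: x + x', a *: y + y')
    & forall x y y', G (x, y) -> G (x, y') -> y = y'].

Definition adjoint_graph (G : set (H * H)) : set (H * H) :=
  [set p : H * H | forall x y, G (x, y) -> <[p.1, y]> = <[p.2, x]>].

Definition self_adjoint (G : set (H * H)) : Prop :=
  [/\ linear_operator G, dense (graph_dom G) & adjoint_graph G = G].

(* Closure of the restriction of G to E, provided that E is in the domain. *)
Definition is_core (E : set H) (G : set (H * H)) : Prop :=
  E `<=` graph_dom G /\ closure [set p : H * H | G p /\ E p.1] = G.

(* W t = e^{itA}: by Stone's theorem this is the strongly continuous
   one-parameter unitary group whose generator is A, that is,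
   D(A) is the set of x for which t^-1 (W t x - x) converges as t -> 0,
   and the limit is then i A x. *)
Definition exp_group (A : set (H * H)) (W : R -> H -> H) : Prop :=
  [/\ forall t, unitary (W t),
      forall x, W 0 x = x,
      forall s t x, W (s + t) x = W s (W t x),
      forall x, continuous (W ^~ x)
    & A = [set p : H * H | (t%:C)^-1 *: (W t p.1 - p.1) @[t --> 0^'] --> 'i *: p.2]].

(* f : R -> H is of class C^1; H being a complex space, the difference
   quotients are scaled by the embedding R -> R[i]. *)
Definition class_C1 (f : R -> H) : Prop :=
  exists2 f' : R -> H, continuous f' &
    forall t, (h%:C)^-1 *: (f (t + h) - f t) @[h --> 0^'] --> f' t.

(* S \in C^1(A): t |-> e^{-itA} S e^{itA} is strongly of class C^1. *)
Definition C1 (A : set (H * H)) (S : H -> H) : Prop :=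
  bounded_operator S /\
  exists2 W, exp_group A W & forall x, class_C1 (fun t => W (- t) (S (W t x))).

(* T is the bounded operator associated with the continuous extension of
   the quadratic form x |-> <x, S A x> - <A x, S x> on D(A). *)
Definition is_commutator (S : H -> H) (A : set (H * H)) (T : H -> H) : Prop :=
  bounded_operator T /\
  forall x y, A (x, y) -> <[x, S y]> - <[y, S x]> = <[x, T x]>.

(* [S, A]; is_commutator S A is satisfied by exactly one T when A is
   self-adjoint and S \in C^1(A). *)
Definition commutator (S : H -> H) (A : set (H * H)) : H -> H :=
  xget (fun _ => 0) (is_commutator S A).

(* [A, S] = - [S, A] *)
Definition commutator_l (A : set (H * H)) (S : H -> H) : H -> H :=
  fun x => - commutator S A x.

(* N^-1 [A, U^N] U^-N *)
Definition commutator_mean (A : set (H * H)) (U : H -> H) (N : nat) : H -> H :=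
  fun x => N%:R^-1 *: commutator_l A (iter N U) (iter N (op_inv U) x).

(* The closure of x |-> (A D + D A) x on D(A). *)
Definition anticommutator (A : set (H * H)) (D : H -> H) : set (H * H) :=
  closure [set p : H * H | exists y z,
    [/\ A (p.1, y), A (D p.1, z) & p.2 = z + D y]].

(* x |-> N^-1 \sum_(n < N) U^n B U^-n x on D(B). Membership in the graph
   requires every U^-n x to be in D(B), so that for this operator to have
   domain D(B) is a claim about B and U. *)
Definition average (B : set (H * H)) (U : H -> H) (N : nat) : set (H * H) :=
  [set p : H * H | graph_dom B p.1 /\ exists y : nat -> H,
    (forall n, (n < N)%N -> B (iter n (op_inv U) p.1, y n)) /\
    p.2 = N%:R^-1 *: \sum_(n < N) iter n U (y n)].

End HilbertSpaceOperators.

(* Main.v *)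
Require Import Defs.
From HB Require Import structures.
From mathcomp Require Import all_boot all_order all_algebra complex.
From mathcomp Require Import all_classical all_reals all_analysis.
From mathcomp Require Import ring lra.
Import Order.TTheory GRing.Theory Num.Theory.
Import numFieldNormedType.Exports.
Local Open Scope classical_set_scope.
Local Open Scope ring_scope.

(** Conjugating A by U^n changes it only by a bounded operator. Write K_n = A
    - U^n A U^-n = [A, U^n] U^-n. Since U is of class C^1(A), the operator K_1
    is bounded; it is symmetric, as a difference of two self-adjoint
    operators, and so is K_n, the sum of the U^k K_1 U^-k over k < n. For K_1
    to make sense everywhere, U must map the domain of A onto itself: U^-1 A U
    is a symmetric extension of a bounded symmetric perturbation of A, and a
    self-adjoint operator has no proper symmetric extension ([conj_defect1],
    [conj_defect_iter]).

    The operator D is the strong limit of K_N / N. It is symmetric because the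
    K_N are, and K_(N+1) = K_1 + U K_N U^-1 shows, after division by N, that D
    commutes with U ([mean_limit_symmetric], [mean_limit_commutes]). Hence, on
    the domain of A,
      U^n (A D + D A) U^-n = (A - K_n) D + D (A - K_n)
                           = (A D + D A) - (K_n D + D K_n),
    and by closure the same relation holds between U^n A_D U^-n and A_D
    ([anticommutator_conj]). Averaging over n < N, the operator of the theorem
    is A_D minus a bounded symmetric operator ([averageE]). Such a
    perturbation keeps the domain, self-adjointness
    ([self_adjoint_perturbation]) and cores, and the domain of A is a core for
    A_D by the definition of A_D as a closure.

    There remains the self-adjointness of A_D ([anticommutator_self_adjoint]).
    Let (x, y) belong to the graph of its adjoint. Moving D across the scalar
    product and using A D = D A + [A, D], one finds that D x is in the domain
    of A and that y = 2 A D x - [A, D] x. To see that (x, y) is in the closure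
    of the graph of A D + D A on the domain of A, regularise x by the
    resolvents R_n = (1 + i A / (n + 1))^-1: the commutator of D with R_n is
    small enough for (A D + D A) R_n x to converge to y. The resolvents come
    from the triviality of the orthogonal complement of the range of 1 + i A /
    (n + 1), hence from the completeness of the space ([closed_subspace_full],
    [resolvent_seq]).

    Finally, the hypotheses of class C^1 yield bounded commutators
    ([C1_commutator]): up to a factor, [S, A] is the derivative at 0 of t |->
    e^(-itA) S e^(itA), a pointwise limit of bounded operators, and such a
    limit is bounded by the uniform boundedness principle
    ([pointwise_limit_continuous]). *)

Set Implicit Arguments.
Unset Strict Implicit.

(** * The scalar product *)

Section InnerProduct.
Variables (R : realType) (H : hilbertType R).
Implicit Types x y z : H.
Let C : numFieldType := R[i]%C.

Lemma innerC x y : inner x y = (inner y x)^*.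
Proof. by rewrite /inner hermC expr0 mul1r. Qed.

Lemma innerDr x y z : inner x (y + z) = inner x y + inner x z.
Proof. exact: linearDl. Qed.

Lemma innerZr a x y : inner x (a *: y) = a * inner x y.
Proof. exact: linearZl_LR. Qed.

Lemma innerDl x y z : inner (x + y) z = inner x z + inner y z.
Proof. by rewrite /inner linearDr. Qed.

Lemma innerZl a x y : inner (a *: x) y = a^* * inner x y.
Proof. by rewrite /inner linearZr_LR. Qed.

Lemma innerNr x y : inner x (- y) = - inner x y.
Proof. by rewrite -scaleN1r innerZr mulN1r. Qed.

Lemma innerNl x y : inner (- x) y = - inner x y.
Proof. by rewrite innerC innerNr rmorphN [in RHS]innerC. Qed.

Lemma innerBr x y z : inner x (y - z) = inner x y - inner x z.
Proof. by rewrite innerDr innerNr. Qed.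

Lemma innerBl x y z : inner (x - y) z = inner x z - inner y z.
Proof. by rewrite innerDl innerNl. Qed.

Lemma inner0r x : inner x 0 = 0.
Proof. by rewrite -(scale0r 0) innerZr mul0r. Qed.

Lemma inner0l x : inner 0 x = 0.
Proof. by rewrite innerC inner0r rmorph0. Qed.

Lemma inner_norm x : inner x x = `|x| ^+ 2.
Proof. by rewrite hform_norm. Qed.

Lemma inner_eq0 x : inner x x = 0 -> x = 0.
Proof.
by rewrite inner_norm => /eqP; rewrite expf_eq0 /= normr_eq0 => /eqP.
Qed.

(** By polarization the scalar product is a polynomial in norms of linear
    combinations of its arguments, and these norms are continuous. *)
Lemma cvg_inner (I : Type) (F : set_system I) (FF : Filter F)
    (f g : I -> H) (x y : H) :
  f i @[i --> F] --> x -> g i @[i --> F] --> y ->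
  (inner (f i) (g i) : C) @[i --> F] --> (inner x y : C).
Proof.
have polar (u v : H) : inner u v = 4^-1 * (`|u + v| ^+ 2 - `|u - v| ^+ 2
    - 'i * `|u + 'i *: v| ^+ 2 + 'i * `|u - 'i *: v| ^+ 2).
  have ii : 'i * 'i = -1 :> R[i] by rewrite -expr2 sqrCi.
  rewrite -!inner_norm !(innerDl, innerDr, innerBl, innerBr, innerNl, innerNr,
    innerZl, innerZr) conjCi.
  apply: (@mulfI _ 4); first by rewrite pnatr_eq0.
  rewrite mulrA divff ?pnatr_eq0// mul1r.
  rewrite !(mulrDr, mulrN, mulNr, mulrA, ii, opprK, opprD, opprB, mul1r).
  by ring.
move=> fx gy.
have -> : inner x y = 4^-1 * (`|x + y| ^+ 2 - `|x - y| ^+ 2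
    - 'i * `|x + 'i *: y| ^+ 2 + 'i * `|x - 'i *: y| ^+ 2) by exact: polar.
under eq_fun do rewrite polar.
have sqn (h : I -> H) z : h i @[i --> F] --> z ->
    (`|h i| ^+ 2 : C) @[i --> F] --> (`|z| ^+ 2 : C).
  by move=> hz; under eq_fun do rewrite expr2; rewrite expr2;
     apply: cvgM; exact: cvg_norm.
apply: cvgMr.
apply: cvgD; [apply: cvgB; [apply: cvgB|]|].
- by apply: sqn; apply: cvgD.
- by apply: sqn; apply: cvgB.
- by apply: cvgMr; apply: sqn; apply: cvgD => //; apply: cvgZl_tmp.
- by apply: cvgMr; apply: sqn; apply: cvgB => //; apply: cvgZl_tmp.
Qed.

End InnerProduct.

(** * Closures, bounded operators and adjoint graphs *)

Lemma closed_eq_fun (T : topologicalType) (V : topologicalType) (f g : T -> V) :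
  hausdorff_space V -> continuous f -> continuous g ->
  closed [set x | f x = g x].
Proof.
move=> hV cf cg x clx; apply: hV => A B Afx Bgx.
have [y [/= fgy [Ay By]]] :
    [set x | f x = g x] `&` (f @^-1` A `&` g @^-1` B) !=set0.
  by apply: clx; apply: filterI; [exact: cf|exact: cg].
by exists (f y); split => //; rewrite fgy.
Qed.

Lemma closed_dense (T : topologicalType) (E B : set T) :
  dense E -> closed B -> E `<=` B -> forall x, B x.
Proof.
move=> dE cB EB x; apply: contrapT => nBx.
have [y [nBy Ey]] : ~` B `&` E !=set0.
  by apply: dE; [exists x|exact: closed_openC].
exact: nBy (EB _ Ey).
Qed.

Lemma closure_preimage_sub (T V : topologicalType) (f : T -> V) (S : set T)
    (S' : set V) :
  continuous f -> S `<=` f @^-1` S' -> closure S `<=` f @^-1` closure S'.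
Proof.
move=> cf SS'; have /closure_id -> : closed (f @^-1` closure S').
  by move/continuous_closedP: cf; apply; exact: closed_closure.
by apply: closureS => x Sx; apply: subset_closure; exact: SS'.
Qed.

Lemma closure_preimage_homeo (T V : topologicalType) (f : T -> V) (g : V -> T)
    (S : set V) :
  continuous f -> continuous g -> cancel f g -> cancel g f ->
  closure (f @^-1` S) = f @^-1` closure S.
Proof.
move=> cf cg fK gK; apply/seteqP; split; first exact: closure_preimage_sub.
move=> x /= Sfx; rewrite -(fK x).
have := @closure_preimage_sub _ _ g S (f @^-1` S) cg.
by apply => // y /= Sy; rewrite gK.
Qed.

Section Operators.
Variables (R : realType) (H : hilbertType R).
Implicit Types (x y z : H) (S T : H -> H) (G A : set (H * H)).
Let C : numFieldType := R[i]%C.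

Lemma opD S x y : linear S -> S (x + y) = S x + S y.
Proof. by move=> lS; rewrite -[x]scale1r lS !scale1r. Qed.

Lemma op0 S : linear S -> S 0 = 0.
Proof.
by move=> lS; apply: (addrI (S 0)); rewrite -opD// !addr0.
Qed.

Lemma opZ S (a : C) x : linear S -> S (a *: x) = a *: S x.
Proof. by move=> lS; rewrite -[a *: x]addr0 lS op0// addr0. Qed.

Lemma opN S x : linear S -> S (- x) = - S x.
Proof. by move=> lS; rewrite -scaleN1r opZ// scaleN1r. Qed.

Lemma opB S x y : linear S -> S (x - y) = S x - S y.
Proof. by move=> lS; rewrite opD// opN. Qed.

Lemma bounded_operatorD S T : bounded_operator S -> bounded_operator T ->
  bounded_operator (fun x => S x + T x).
Proof.
move=> [lS cS] [lT cT]; split=> [a x y|x]; last first.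
  by apply: cvgD; [exact: cS|exact: cT].
by rewrite lS lT scalerDr addrACA.
Qed.

Lemma bounded_operator_comp S T : bounded_operator S -> bounded_operator T ->
  bounded_operator (fun x => S (T x)).
Proof.
move=> [lS cS] [lT cT]; split=> [a x y|x]; first by rewrite lT lS.
by apply: (@continuous_comp _ _ _ T S); [exact: cT|exact: cS].
Qed.

Lemma bounded_operatorZ (a : C) S : bounded_operator S ->
  bounded_operator (fun x => a *: S x).
Proof.
move=> [lS cS]; split=> [b x y|x]; last by apply: cvgZl_tmp; exact: cS.
by rewrite lS scalerDr !scalerA mulrC.
Qed.

Lemma bounded_operatorN S : bounded_operator S ->
  bounded_operator (fun x => - S x).
Proof.
by move=> /(bounded_operatorZ (-1)); under eq_fun do rewrite scaleN1r.
Qed.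

Lemma bounded_operator0 : bounded_operator (fun=> 0 : H).
Proof. by split=> [b x y|x]; [rewrite scaler0 addr0|exact: cvg_cst]. Qed.

Lemma hilbert_hausdorff : hausdorff_space H.
Proof. exact: norm_hausdorff. Qed.

Lemma inner_continuousl (f g : H * H -> H) : continuous f -> continuous g ->
  continuous (fun p => inner (f p) (g p) : C).
Proof. by move=> cf cg p; apply: cvg_inner; [exact: cf|exact: cg]. Qed.

Lemma closed_inner_eq (f1 g1 f2 g2 : H * H -> H) :
  continuous f1 -> continuous g1 -> continuous f2 -> continuous g2 ->
  closed [set p | inner (f1 p) (g1 p) = inner (f2 p) (g2 p)].
Proof.
move=> cf1 cg1 cf2 cg2.
apply: (@closed_eq_fun _ C); first exact: norm_hausdorff.
- exact: inner_continuousl.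
- exact: inner_continuousl.
Qed.

Lemma continuous_eq_dense (E : set H) S T :
  dense E -> continuous S -> continuous T ->
  (forall x, E x -> S x = T x) -> forall x, S x = T x.
Proof.
move=> dE cS cT ST; apply: (@closed_dense _ E) => //.
by apply: closed_eq_fun => //; exact: hilbert_hausdorff.
Qed.

Lemma orthogonal_dense (E : set H) z :
  dense E -> (forall x, E x -> inner z x = 0) -> z = 0.
Proof.
move=> dE zE; apply: inner_eq0; move: {2}z.
have cz : continuous (fun x => inner z x : C).
  by move=> x; apply: cvg_inner; [exact: cvg_cst|exact: cvg_id].
apply: (@closed_dense _ E) => //.
apply: (@closed_eq_fun _ C); [exact: norm_hausdorff|exact: cz|].
by move=> x; exact: cvg_cst.
Qed.

(** Two successive extensions by continuity, one in each argument; this is how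
    symmetry relations pass from the domain of A to the whole space. *)
Lemma inner_eq_dense (E : set H) (f1 g1 f2 g2 : H -> H) : dense E ->
  continuous f1 -> continuous g1 -> continuous f2 -> continuous g2 ->
  (forall x y, E x -> E y -> inner (f1 x) (g1 y) = inner (f2 x) (g2 y)) ->
  forall x y, inner (f1 x) (g1 y) = inner (f2 x) (g2 y).
Proof.
move=> dE cf1 cg1 cf2 cg2 fg x y.
have cl (h1 h2 k1 k2 : H -> H) : continuous h1 -> continuous h2 ->
    continuous k1 -> continuous k2 ->
    closed [set u | inner (h1 u) (h2 u) = inner (k1 u) (k2 u)].
  move=> ch1 ch2 ck1 ck2; apply: (@closed_eq_fun _ C) => [|u|u].
  - exact: norm_hausdorff.
  - by apply: cvg_inner; [exact: ch1|exact: ch2].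
  - by apply: cvg_inner; [exact: ck1|exact: ck2].
have cst (u : H) : continuous (fun _ : H => u) by move=> v; exact: cvg_cst.
move: y; apply: (@closed_dense _ E) => //.
  exact: (cl (fun=> f1 x) g1 (fun=> f2 x)).
move=> y Ey /=; move: x; apply: (@closed_dense _ E) => //.
  exact: (cl f1 (fun=> g1 y) f2 (fun=> g2 y)).
by move=> x Ex; exact: fg.
Qed.

Lemma adjoint_graph_closed G : closed (adjoint_graph G).
Proof.
rewrite (_ : adjoint_graph G = \bigcap_(q in G)
    [set p : H * H | inner p.1 q.2 = inner p.2 q.1]).
  apply: closed_bigI => q _; apply: closed_inner_eq.
  - by move=> p; exact: cvg_fst.
  - by move=> p; exact: cvg_cst.
  - by move=> p; exact: cvg_snd.
  - by move=> p; exact: cvg_cst.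
by apply/seteqP; split=> [p Gp [x y] /Gp //|p Gp x y Gxy]; exact: (Gp (x, y)).
Qed.

(** An adjoint graph is always a linear subspace, and it is single-valued when
    its original is densely defined; the linearity required of a self-adjoint
    graph thus comes for free. *)
Lemma self_adjointI G :
  dense (graph_dom G) -> adjoint_graph G = G -> self_adjoint G.
Proof.
move=> dG aG; split=> //; rewrite -aG.
split=> [x y _|a x y x' y' Gxy Gxy' u v Guv|].
- by rewrite !inner0l.
- by rewrite /= !innerDl !innerZl (Gxy _ _ Guv) (Gxy' _ _ Guv).
- move=> x y y' Gxy Gxy'; apply/eqP; rewrite -subr_eq0; apply/eqP.
  apply: (orthogonal_dense dG) => u [v Guv].
  by rewrite innerBl -(Gxy _ _ Guv) -(Gxy' _ _ Guv) subrr.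
Qed.

Definition symmetric_op S := forall x y, inner (S x) y = inner x (S y).

Lemma self_adjoint_closed A : self_adjoint A -> closed A.
Proof. by case=> _ _ <-; exact: adjoint_graph_closed. Qed.

Lemma self_adjointP A x y : self_adjoint A ->
  (forall u v, A (u, v) -> inner x v = inner y u) -> A (x, y).
Proof. by case=> _ _ aA h; rewrite -aA; exact: h. Qed.

Lemma self_adjoint_sym A x y u v : self_adjoint A ->
  A (x, y) -> A (u, v) -> inner x v = inner y u.
Proof. by case=> _ _ aA; rewrite -{1}aA => h /h. Qed.

(** The graph below is that of A - S. Shifting by S leaves the domain of A and
    the domain of its adjoint unchanged. *)
Lemma self_adjoint_perturbation A S : self_adjoint A ->
  bounded_operator S -> symmetric_op S ->
  self_adjoint [set p | A (p.1, p.2 + S p.1)].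
Proof.
move=> sA [lS cS] sS.
have domE : graph_dom [set p | A (p.1, p.2 + S p.1)] = graph_dom A.
  apply/seteqP; split=> x [y Axy].
    by exists (y + S x).
  by exists (y - S x); rewrite /= subrK.
apply: self_adjointI; first by rewrite domE; case: sA.
apply/seteqP; split=> -[x y] /=.
  move=> Sxy; apply: self_adjointP => // u v Auv.
  have /= := Sxy u (v - S u); rewrite subrK => /(_ Auv).
  by rewrite innerBr innerDl -sS => <-; rewrite subrK.
move=> Axy u v /= Auv.
have := self_adjoint_sym sA Axy Auv.
by rewrite /= innerDl innerDr sS => /addIr.
Qed.

Lemma symmetric_op_sum (F : nat -> H -> H) n : (forall i, symmetric_op (F i)) ->
  symmetric_op (fun x => \sum_(i < n) F i x).
Proof.
move=> sF x y; elim: n => [|n IH]; first by rewrite !big_ord0 inner0l inner0r.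
by rewrite !big_ord_recr /= innerDl innerDr IH sF.
Qed.

Lemma bounded_operator_sum (F : nat -> H -> H) n :
  (forall i, bounded_operator (F i)) ->
  bounded_operator (fun x => \sum_(i < n) F i x).
Proof.
move=> bF; elim: n => [|n IH].
  by under eq_fun do rewrite big_ord0; exact: bounded_operator0.
by under eq_fun do rewrite big_ord_recr /=; exact: bounded_operatorD.
Qed.

End Operators.

(** * Closed subspaces with trivial orthogonal complement *)

Section Completeness.
Variable (R : realType).
Let C : numFieldType := R[i]%C.

Lemma complex_gt0E (e : C) : 0 < e -> exists2 r : R, 0 < r & e = r%:C%C.
Proof.
move=> e0; exists (complex.Re e); last by rewrite RRe_real// gtr0_real.
by rewrite -ltcR RRe_real// gtr0_real.
Qed.

Lemma conj_real_complex (r : R) : (r%:C%C : R[i])^* = r%:C%C.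
Proof. by rewrite conj_Creal//; apply/complex_realP; exists r. Qed.

Lemma natV_real_complex n : (n%:R^-1 : C) = (n%:R^-1 : R)%:C%C.
Proof.
have -> : (n%:R^-1 : R)%:C%C = real_complex R n%:R^-1 by [].
by rewrite fmorphV rmorph_nat.
Qed.

Lemma cvg_invSn : (n.+1%:R^-1 : C) @[n --> \oo] --> (0 : C).
Proof.
apply/cvgrPdist_lt => e /complex_gt0E [r r0 ->].
near=> n; rewrite sub0r normrN ger0_norm ?invr_ge0 ?ler0n//.
rewrite natV_real_complex ltcR.
by near: n; exact: (near_infty_natSinv_lt (PosNum r0)).
Unshelve. all: by end_near. Qed.

(** It is enough to compare with a single term u N, since the triangle
    inequality then controls the other differences. *)
Lemma cauchy_seq_cvg (V : completeNormedModType C) (u : nat -> V) :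
  (forall e : C, 0 < e -> exists N, forall n, (N <= n)%N -> `|u N - u n| < e) ->
  exists l : V, u n @[n --> \oo] --> l.
Proof.
move=> cu; suff : cvg (u @ \oo) by move=> ul; exists (lim (u @ \oo)).
apply: cauchy_cvg; apply: cauchy_exP => e /cu [N uN].
by exists (u N); exists N => // n /= /uN; rewrite -ball_normE.
Qed.

Lemma closure_seq (V : normedModType C) (E : set V) x : closure E x ->
  exists2 u : nat -> V, (forall n, E (u n)) & u n @[n --> \oo] --> x.
Proof.
move=> clx.
have /choice [u uP] : forall n, exists y, E y /\ `|x - y| < n.+1%:R^-1.
  move=> n; have [|y [Ey]] := clx (ball x (n.+1%:R^-1)).
    by apply: nbhsx_ballx; rewrite invr_gt0.
  by rewrite -ball_normE; exists y.
exists u => [n|]; first by have [] := uP n.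
apply/cvgrPdist_lt => e e0; near=> n.
apply: lt_trans (uP n).2 _.
have : `|0 - n.+1%:R^-1 : C| < e.
  by near: n; apply: cvgr_dist_lt => //; exact: cvg_invSn.
by rewrite sub0r normrN ger0_norm ?invr_ge0 ?ler0n.
Unshelve. all: by end_near. Qed.

End Completeness.

Section Projection.
Variables (R : realType) (H : hilbertType R).
Implicit Types (x y z : H).
Let C : numFieldType := R[i]%C.

Let q x : R := complex.Re (inner x x).

Lemma sqnormE x : inner x x = (q x)%:C%C.
Proof. by rewrite RRe_real// inner_norm realX// normr_real. Qed.

Let q_ge0 x : 0 <= q x.
Proof. by rewrite -lecR -sqnormE inner_norm exprn_ge0. Qed.

Let parallelogram x y : q (x - y) = 2 * q x + 2 * q y - q (x + y).
Proof.
apply: complexI; rewrite -sqnormE rmorphB rmorphD !rmorphM /= -!sqnormE.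
rewrite !(innerDl, innerDr, innerBl, innerBr, innerNl, innerNr).
rewrite !rmorphMn /= !rmorph1.
by ring.
Qed.

Let norm_lt x (r : R) : 0 < r -> (`|x| < r%:C%C) = (q x < r ^+ 2).
Proof.
move=> r0; rewrite -ltcR -sqnormE inner_norm rmorphXn /=.
by rewrite ltr_pXn2r// nnegrE ?normr_ge0// ler0c ltW.
Qed.

Let cvg_q (u : nat -> H) x : u n @[n --> \oo] --> x ->
  q (u n) @[n --> \oo] --> q x.
Proof.
move=> ux; apply/cvgrPdist_lt => e e0; near=> n.
rewrite -ltcR; apply: le_lt_trans (_ : `|inner x x - inner (u n) (u n)| < _).
  by rewrite !sqnormE -rmorphB; apply: le_trans (normc_ge_Re _); rewrite lecR.
by near: n; apply: (@cvgr_dist_lt _ C); [exact: cvg_inner|rewrite ltcR].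
Unshelve. all: by end_near. Qed.

(** A minimizing sequence for the distance of h to M is Cauchy by the
    parallelogram identity. Its limit m is a point of M at minimal distance,
    so that h - m is orthogonal to M, hence zero. *)
Lemma closed_subspace_full (M : set H) :
  M 0 -> (forall (a : C) x y, M x -> M y -> M (a *: x + y)) -> closed M ->
  (forall z, (forall m, M m -> inner m z = 0) -> z = 0) -> forall h, M h.
Proof.
move=> M0 Mlin Mcl Morth h.
pose E := [set q (h - m) | m in M].
have Elb : has_lbound E by exists 0 => _ [m _ <-].
have Einf : has_inf E by split => //; exists (q (h - 0)); exists 0.
have dle m : M m -> inf E <= q (h - m).
  by move=> Mm; apply: ge_inf => //; exists m.
have /choice [u uP] : forall n, exists m, M m /\ q (h - m) < inf E + n.+1%:R^-1.
  move=> n; have [|_ [m Mm <-] ?] := @inf_adherent _ _ (n.+1%:R^-1) _ Einf.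
    by rewrite invr_gt0.
  by exists m.
have u_close N n : (N <= n)%N -> q (u N - u n) < 4 * N.+1%:R^-1.
  move=> Nn.
  have -> : u N - u n = (h - u n) - (h - u N).
    by rewrite opprB [RHS]addrC addrA subrK.
  rewrite parallelogram.
  have -> : h - u n + (h - u N) = 2 *: (h - 2^-1 *: (u n + u N)).
    rewrite scalerBr scalerA divff ?pnatr_eq0// scale1r scaler_nat mulr2n.
    by rewrite opprD addrACA.
  have -> : q (2 *: (h - 2^-1 *: (u n + u N))) =
      4 * q (h - 2^-1 *: (u n + u N)).
    apply: complexI; rewrite rmorphM /= -!sqnormE innerZl innerZr conjC_nat.
    by rewrite mulrA -natrM rmorph_nat.
  have /dle : M (2^-1 *: (u n + u N)).
    rewrite -[_ *: _]addr0; apply: (Mlin) => //.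
    by rewrite -[u n]scale1r; apply: (Mlin); [case: (uP n)|case: (uP N)].
  have [_ ] := uP n; have [_ ] := uP N.
  have : n.+1%:R^-1 <= N.+1%:R^-1 :> R by rewrite lef_pV2 ?posrE// ler_nat.
  move: (n.+1%:R^-1) (N.+1%:R^-1) (q (h - u n)) (q (h - u N)) => *.
  by lra.
have [m um] : exists m : H, u n @[n --> \oo] --> m.
  apply: cauchy_seq_cvg => e /complex_gt0E [r r0 ->].
  have r20 : 0 < r ^+ 2 / 4 by rewrite divr_gt0// exprn_gt0.
  have [N _ /(_ N (leqnn N)) /= Nr] := near_infty_natSinv_lt (PosNum r20).
  exists N => n Nn; rewrite norm_lt//; apply: lt_trans (u_close _ _ Nn) _.
  by rewrite mulrC -ltr_pdivlMr.
have Mm : M m.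
  by apply: (closed_cvg M) um => //; apply: nearW => n; case: (uP n).
have mmin v : M v -> q (h - m) <= q (h - m - v).
  move=> Mv; apply: (@ler_cvg_to _ \oo _ _
    (fun n => q (h - u n) - n.+1%:R^-1) (fun n => q (h - u n - v))).
  - rewrite -[X in _ --> X]subr0; apply: cvgB; last exact: cvg_harmonic.
    by apply: cvg_q; apply: cvgB => //; exact: cvg_cst.
  - by apply: cvg_q; apply: cvgB; [apply: cvgB|] => //; exact: cvg_cst.
  - apply: nearW => n; rewrite -addrA -opprD.
    have [Mun] := uP n; rewrite -ltrBlDr => /ltW/le_trans; apply; apply: dle.
    by rewrite -[u n]scale1r; exact: Mlin.
suff : h - m = 0 by move/eqP; rewrite subr_eq0 => /eqP ->.
move: (h - m) mmin => z mmin; apply: Morth => v Mv; set c := inner v z.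
have cc_real : c * c^* = (complex.Re (c * c^*))%:C%C.
  by rewrite RRe_real// ger0_real// mul_conjC_ge0.
set cc := complex.Re _ in cc_real.
have cc0 : 0 <= cc by rewrite -lecR -cc_real mul_conjC_ge0.
(* compares m with its displacement by s c v, for c = <v, h - m> and small s *)
have key (s : R) : 0 <= s -> 0 <= s ^+ 2 * cc * q v - 2 * s * cc.
  move=> s0; have /mmin : M ((s%:C%C * c) *: v).
    by rewrite -[_ *: _]addr0; exact: Mlin.
  rewrite -subr_ge0; apply: etrans; congr (0 <= _).
  apply: complexI; rewrite !rmorphB !rmorphM /= -!sqnormE.
  rewrite !(innerDl, innerDr, innerNl, innerNr, innerZl, innerZr).
  rewrite -/c [inner z v]innerC -/c -cc_real rmorphM /= conj_real_complex.
  by rewrite rmorph_nat /=; ring.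
suff cc_eq0 : cc = 0.
  by move/eqP: cc_real; rewrite cc_eq0 mul_conjC_eq0 => /eqP.
(* any s > 0 with s * q v < 2 would do; this one also covers v = 0 *)
have := key (q v + 1)^-1; rewrite invr_ge0 addr_ge0// => /(_ isT).
have q1 : 0 < q v + 1 by rewrite ltr_wpDl.
set s := (q v + 1)^-1; have sq : s * (q v + 1) = 1 by rewrite mulVf// gt_eqF.
have s0 : 0 < s by rewrite invr_gt0.
have -> : s ^+ 2 * cc * q v - 2 * s * cc = - (s * (cc * (1 + s))).
  have sE : s * q v = 1 - s by rewrite -sq; ring.
  have -> : s ^+ 2 * cc * q v = s * cc * (s * q v) by ring.
  by rewrite sE; ring.
rewrite oppr_ge0 pmulr_rle0// pmulr_lle0 ?addr_gt0// => cc_le0.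
by apply/eqP; rewrite eq_le cc_le0.
Qed.

End Projection.

(** * Resolvents of a self-adjoint operator *)

Lemma closed_pair_lim (T V : topologicalType) (G : set (T * V))
    (u : nat -> T) (v : nat -> V) (x : T) (y : V) :
  closed G -> (forall n, G (u n, v n)) ->
  u n @[n --> \oo] --> x -> v n @[n --> \oo] --> y -> G (x, y).
Proof.
move=> Gcl Guv ux vy.
apply: (@closed_cvg _ _ \oo _ (fun n => (u n, v n)) G) => //.
  exact: nearW.
exact: cvg_pair ux vy.
Qed.

Section Resolvent.
Variables (R : realType) (H : hilbertType R) (A : set (H * H)).
Hypothesis sA : self_adjoint A.
Implicit Types (x y z h : H).
Let C : numFieldType := R[i]%C.

Lemma graphP (a : C) x y x' y' :
  A (x, y) -> A (x', y') -> A (a *: x + x', a *: y + y').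
Proof. by case: sA => -[_ lA _] _ _; exact: lA. Qed.

Lemma graph_fun x y y' : A (x, y) -> A (x, y') -> y = y'.
Proof. by case: sA => -[_ _ fA] _ _; exact: fA. Qed.

Lemma graph0 : A (0, 0).
Proof. by case: sA => -[]. Qed.

Lemma graphZ (a : C) x y : A (x, y) -> A (a *: x, a *: y).
Proof.
by move=> Axy; rewrite -[a *: x]addr0 -[a *: y]addr0; exact: graphP graph0.
Qed.

Lemma graphD x y x' y' : A (x, y) -> A (x', y') -> A (x + x', y + y').
Proof. by move=> Axy Axy'; have := graphP 1 Axy Axy'; rewrite !scale1r. Qed.

Lemma graphB x y x' y' : A (x, y) -> A (x', y') -> A (x - x', y - y').
Proof.
move=> Axy Axy'; apply: graphD => //.
by rewrite -scaleN1r -[- y']scaleN1r; exact: graphZ.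
Qed.

Section OneResolvent.
Variable e : R.
Hypothesis e0 : e != 0.
Let c : C := 'i * e%:C%C.

Let cJ : (c : R[i])^* = - c.
Proof. by rewrite rmorphM /= conjCi conj_real_complex mulNr. Qed.

Let c0 : c != 0.
Proof.
rewrite mulf_neq0 ?neq0Ci// -(rmorph0 (real_complex R)).
by rewrite (inj_eq (@complexI _)).
Qed.

(** Since A is symmetric and c is purely imaginary, the mixed terms cancel:
    the squared norm of x + c y is that of x plus e^2 times that of y. In
    particular 1 + c A is injective with contractive inverse. *)
Lemma resolvent_norm x y : A (x, y) -> `|x| <= `|x + c *: y|.
Proof.
move=> Axy; rewrite -(@ler_pXn2r _ 2)// ?nnegrE// -!inner_norm.
rewrite !(innerDl, innerDr, innerZl, innerZr) cJ.
rewrite (self_adjoint_sym sA Axy Axy).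
have -> : inner x x + c * inner y x + (- c * inner y x + - c * (c * inner y y))
   = inner x x + e%:C%C ^+ 2 * inner y y.
  have -> : - c * (c * inner y y) = (- ('i * 'i)) * e%:C%C ^+ 2 * inner y y.
    by rewrite /c; ring.
  by rewrite -expr2 sqrCi opprK mul1r; ring.
rewrite lerDl inner_norm mulr_ge0//.
by rewrite -[e%:C%C]/(real_complex R e) -rmorphXn ler0c sqr_ge0.
Qed.

(** The range of 1 + c A is closed because A is closed and 1 + c A is bounded
    below; a vector z orthogonal to it satisfies A z = c^-1 z with c^-1
    imaginary, which the symmetry of A forbids unless z = 0. *)
Lemma resolvent_surj h : exists p, A p /\ p.1 + c *: p.2 = h.
Proof.
pose M := [set p.1 + c *: p.2 | p in A].
suff Mfull : forall h, M h by have [p Ap <-] := Mfull h; exists p.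
apply: closed_subspace_full.
- by exists (0, 0); [exact: graph0|rewrite scaler0 addr0].
- move=> a _ _ [[x y] Axy <-] [[x' y'] Axy' <-].
  exists (a *: x + x', a *: y + y'); first exact: graphP.
  by rewrite /= !scalerDr !scalerA [c * a]mulrC addrACA.
- move=> w /closure_seq [u uM uw].
  have /choice [p pP] : forall n, exists p, A p /\ p.1 + c *: p.2 = u n.
    by move=> n; have [p Ap <-] := uM n; exists p.
  have [x px] : exists x : H, (p n).1 @[n --> \oo] --> x.
    apply: cauchy_seq_cvg => d d0.
    have d20 : 0 < d / 2 by rewrite divr_gt0.
    have [N _ uN] := @cvgr_dist_lt _ _ _ _ _ _ _ uw _ d20.
    exists N => n Nn; apply: le_lt_trans (_ : `|u N - u n| < d).
      have [AN <-] := pP N; have [An <-] := pP n.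
      rewrite opprD addrACA -scalerBr; apply: resolvent_norm.
      by apply: graphB; rewrite -surjective_pairing.
    rewrite -(subrKA w) [d]splitr; apply: le_lt_trans (ler_normD _ _) _.
    by apply: ltrD; [rewrite distrC; exact: (uN N (leqnn N))|exact: (uN n Nn)].
  have py : (p n).2 @[n --> \oo] --> c^-1 *: (w - x).
    have pE n : (p n).2 = c^-1 *: (u n - (p n).1).
      have [_ <-] := pP n; rewrite addrC addKr.
      by rewrite scalerA mulVf// scale1r.
    by under eq_fun do rewrite pE; apply: cvgZl_tmp; exact: cvgB.
  exists (x, c^-1 *: (w - x)); last first.
    by rewrite /= scalerA divff// scale1r subrKC.
  apply: (closed_pair_lim (self_adjoint_closed sA) _ px py) => n.
  by rewrite -surjective_pairing; case: (pP n).
- move=> z zM.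
  have zA x y : A (x, y) -> inner z x + c * inner z y = 0.
    move=> Axy; rewrite -innerZr -innerDr innerC.
    by rewrite zM ?rmorph0//; exists (x, y).
  have Az : A (z, c^-1 *: z).
    apply: (self_adjointP sA) => x y /zA /eqP; rewrite addrC addr_eq0 => /eqP E.
    rewrite innerZl fmorphV /= cJ invrN mulNr -[inner z x]opprK -E.
    by rewrite mulrN mulKf ?opprK.
  have := self_adjoint_sym sA Az Az.
  rewrite innerZl innerZr fmorphV /= cJ invrN.
  rewrite mulNr => /eqP; rewrite -subr_eq0 opprK -mulr2n mulrn_eq0 /=.
  by rewrite mulf_eq0 invr_eq0 (negbTE c0) => /eqP /inner_eq0.
Qed.

End OneResolvent.

Let c n : C := 'i * (n.+1%:R^-1)%:C%C.

(** The operators R_n = (1 + c_n A)^-1 with c_n = i / (n + 1) approximate the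
    identity by operators with values in the domain of A. For h in that
    domain, h - R_n h = c_n R_n (A h) tends to zero, and the bound by 1 on the
    norm of R_n extends this to every h, even along convergent sequences. *)
Lemma resolvent_seq : exists Rn : nat -> H -> H, exists cn : nat -> C,
  [/\ forall n h, A (Rn n h, (cn n)^-1 *: (h - Rn n h)),
      forall n x y, A (x, y) -> A (Rn n x, Rn n y),
      forall n x y, A (x, y) -> Rn n (x + cn n *: y) = x,
      forall n, linear (Rn n) /\ cn n != 0 &
      forall (u : nat -> H) x, u n @[n --> \oo] --> x ->
        Rn n (u n) @[n --> \oo] --> x].
Proof.
have e0 n : n.+1%:R^-1 != 0 :> R by rewrite invr_eq0 pnatr_eq0.
have cn0 n : c n != 0.
  rewrite mulf_neq0 ?neq0Ci// -(rmorph0 (real_complex R)).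
  by rewrite (inj_eq (@complexI _)).
have /choice [Rn' Rn'P] : forall nh : nat * H,
    exists p, A p /\ p.1 + c nh.1 *: p.2 = nh.2.
  by move=> [n h]; exact: resolvent_surj.
pose Rn n h := (Rn' (n, h)).1.
have RnP n h : A (Rn n h, (c n)^-1 *: (h - Rn n h)).
  have [/= ] := Rn'P (n, h); rewrite /Rn; case: (Rn' _) => x y /= Axy <-.
  by rewrite addrAC subrr add0r scalerA mulVf// scale1r.
have cK n x : c n *: ((c n)^-1 *: x) = x by rewrite scalerA divff// scale1r.
have RnE n x y h : A (x, y) -> x + c n *: y = h -> x = Rn n h.
  move=> Axy <-; apply/eqP; rewrite -subr_eq0 -normr_le0.
  have AB := graphB Axy (RnP n (x + c n *: y)).
  apply: le_trans (resolvent_norm n.+1%:R^-1 AB) _.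
  rewrite -[_ * _]/(c n) scalerBr cK addrACA -opprD subrKC.
  by rewrite subrr normr0.
have Rlin n : linear (Rn n).
  move=> a x y; apply/esym.
  apply: (RnE n _ _ _ (graphP a (RnP n x) (RnP n y))).
  rewrite scalerDr [c n *: (a *: _)]scalerA mulrC -scalerA !cK addrACA.
  by rewrite -scalerDr !subrKC.
have Rcomm n x y : A (x, y) -> Rn n y = (c n)^-1 *: (x - Rn n x).
  move=> Axy; apply/esym.
  apply: (RnE n _ _ _ (graphZ (c n)^-1 (graphB Axy (RnP n x)))).
  by rewrite cK subrKC.
have Rle n h : `|Rn n h| <= `|h|.
  by apply: le_trans (resolvent_norm n.+1%:R^-1 (RnP n h)) _; rewrite cK subrKC.
exists Rn, c; split => //.
- by move=> n x y /Rcomm ->; exact: RnP.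
- by move=> n x y Axy; apply/esym; exact: RnE Axy _.
move=> u x ux; apply/cvgrPdist_lt => e ep.
have e4 : 0 < e / 4 by rewrite divr_gt0.
have [x' [/interior_subset xx' [y' Axy']]] :
    (ball x (e / 4))° `&` graph_dom A !=set0.
  case: sA => _ dA _; apply: dA; last exact: open_interior.
  by exists x; apply: nbhsx_ballx.
(* x' is an approximation of x in the domain of A, with A x' = y' *)
have cy0 : c n *: y' @[n --> \oo] --> (0 : H).
  rewrite -(scale0r y'); apply: cvgZr_tmp; rewrite -(mulr0 'i).
  apply: cvgMr; rewrite (_ : (fun n => _) = fun n => n.+1%:R^-1 : C).
    exact: cvg_invSn.
  by apply/funext => n; rewrite natV_real_complex.
near=> n.
have -> : x - Rn n (u n) =
    (x - x') + c n *: Rn n y' + Rn n (x' - x) + Rn n (x - u n).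
  rewrite (Rcomm _ _ _ Axy') cK -addrA -opD// !subrKA.
  by rewrite opB// subrKA.
rewrite [e](_ : _ = e / 4 + e / 4 + e / 4 + e / 4); last by field.
have tri (a b : H) (r s : C) : `|a| < r -> `|b| < s -> `|a + b| < r + s.
  by move=> ar bs; apply: le_lt_trans (ler_normD _ _) _; exact: ltrD.
apply: (tri); [apply: (tri); [apply: (tri)|]|].
- by move: xx'; rewrite -ball_normE.
- apply: (@le_lt_trans _ _ `|0 - c n *: y'|).
    by rewrite sub0r normrN !normrZ ler_wpM2l.
  by near: n; exact: cvgr_dist_lt.
- by apply: le_lt_trans (Rle _ _) _; move: xx'; rewrite -ball_normE /= distrC.
- by apply: le_lt_trans (Rle _ _) _; near: n; exact: cvgr_dist_lt.
Unshelve. all: by end_near. Qed.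

End Resolvent.

(** * The anticommutator of A and D *)

Section Anticommutator.
Variables (R : realType) (H : hilbertType R) (A : set (H * H)).
Hypothesis sA : self_adjoint A.
Implicit Types (x y z h : H).
Variables (D K : H -> H).
Hypothesis bD : bounded_operator D.
Hypothesis sD : symmetric_op D.
Hypothesis bK : bounded_operator K.
Hypothesis AD : forall x y, A (x, y) -> A (D x, D y + K x).
Let C : numFieldType := R[i]%C.

Let T0 : set (H * H) := [set p : H * H | exists y z,
    [/\ A (p.1, y), A (D p.1, z) & p.2 = z + D y]].

Let T0I x y : A (x, y) -> T0 (x, (D y + K x) + D y).
Proof. by move=> Axy; exists y, (D y + K x); split => //; exact: AD. Qed.

(** K is [A, D] = A D - D A, which is antisymmetric because A and D are
    symmetric. *)
Let skewK x z : inner (K x) z = - inner x (K z).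
Proof.
have [_ cK] := bK; have [_ dA _] := sA.
rewrite -innerNr.
apply: (inner_eq_dense (f1 := K) (g1 := id) (f2 := id)
  (g2 := fun z => - K z) dA) => //.
- by move=> v; exact: cvg_id.
- by move=> v; exact: cvg_id.
- by move=> v; apply: cvgN; exact: cK.
move=> u v [u' Au] [v' Av].
have h1 := self_adjoint_sym sA (AD Au) Av.
have h2 := self_adjoint_sym sA Au (AD Av).
rewrite innerNr; apply/eqP; rewrite -addr_eq0; apply/eqP.
move: h1 h2; rewrite innerDl innerDr !sD => -> /eqP.
by rewrite -addrA eq_sym addrC -subr_eq subrr eq_sym addrC => /eqP.
Qed.

Lemma anticommutator_dom x : graph_dom A x -> graph_dom (anticommutator A D) x.
Proof.
move=> [y Axy]; exists (D y + K x + D y).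
by apply: subset_closure; exact: T0I.
Qed.

(** Given (x, y) in the adjoint graph, D x belongs to the domain of A and w =
    A D x = (y + K x) / 2. With R_n the resolvents and y' n = A R_n x, the
    resolvent identity gives A D R_n x = R_n w + (1 - R_n) K R_n x, which
    converges to w; hence D A R_n x = A D R_n x - K R_n x converges to w - K
    x, and the sum to 2 w - K x = y. *)
Lemma anticommutator_self_adjoint : self_adjoint (anticommutator A D).
Proof.
have [lD cD] := bD; have [lK cK] := bK; have [_ dA _] := sA.
apply: self_adjointI.
  move=> O O0 oO; have [x [Ox Ax]] := dA O O0 oO.
  by exists x; split => //; exact: anticommutator_dom.
have ccst (u : H) : continuous (fun _ : H * H => u).
  by move=> ?; exact: cvg_cst.
have cfst : continuous (fst : H * H -> H) by move=> ?; exact: cvg_fst.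
have csnd : continuous (snd : H * H -> H) by move=> ?; exact: cvg_snd.
apply/seteqP; split=> [[x y] xy|p Tp u v Tuv]; last first.
  have T0sym (p' q' : H * H) : T0 p' -> T0 q' ->
      inner p'.1 q'.2 = inner p'.2 q'.1.
    case: p' q' => [x y] [x' y'].
    move=> [y1 [z1 [/= A1 B1 ->]]] [y2 [z2 [/= A2 B2 ->]]].
    rewrite innerDr innerDl -(self_adjoint_sym sA B1 A2) !sD.
    by rewrite (self_adjoint_sym sA A1 B2) addrC.
  suff : anticommutator A D `<=` [set q | inner p.1 q.2 = inner p.2 q.1].
    by move=> /(_ _ Tuv).
  rewrite /anticommutator closureE; apply: smallest_sub.
    exact: closed_inner_eq.
  move=> q Tq /=; move: p Tp.
  change (anticommutator A D `<=` [set p | inner p.1 q.2 = inner p.2 q.1]).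
  rewrite /anticommutator closureE; apply: smallest_sub.
    exact: closed_inner_eq.
  by move=> p Tp /=; exact: T0sym.
pose w := 2^-1 *: (y + K x).
have ADw : A (D x, w).
  have -> : D x = 2^-1 *: (2 *: D x).
    by rewrite scalerA mulVf ?scale1r// pnatr_eq0.
  apply: graphZ => //; apply: (self_adjointP sA) => u v Auv.
  have /= := xy u _ (subset_closure (T0I Auv)).
  rewrite !innerDr innerDl skewK => <-; rewrite innerZl conjC_nat sD; ring.
have [Rn [c [RnA RnD RnE Rnl Rncvg]]] := resolvent_seq sA.
have Rx : Rn n x @[n --> \oo] --> x by exact: Rncvg (cvg_cst x).
pose z n := Rn n w + (K (Rn n x) - Rn n (K (Rn n x))).
pose y' n := (c n)^-1 *: (x - Rn n x).
have ADR n : A (D (Rn n x), D (y' n) + K (Rn n x)) := AD (RnA n x).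
have zE n : D (y' n) + K (Rn n x) = z n.
  have [lR c0] := Rnl n.
  have Rw : Rn n w = (c n)^-1 *: (D x - Rn n (D x)).
    exact: (graph_fun sA (RnD n _ _ ADw) (RnA n (D x))).
  set zz := D (y' n) + K (Rn n x).
  have e1 : D (Rn n x) + c n *: zz = c n *: K (Rn n x) + D x.
    rewrite /zz scalerDr -opZ// scalerA divff// scale1r opB// addrA subrKC.
    by rewrite addrC.
  have e2 : D (Rn n x) = c n *: Rn n (K (Rn n x)) + Rn n (D x).
    by rewrite -lR -e1 RnE//; exact: ADR.
  apply: (scalerI c0); rewrite -[LHS](addKr (D (Rn n x))) e1 e2 /z Rw.
  rewrite scalerDr scalerA divff// scale1r scalerBr opprD.
  by rewrite [LHS]addrC addrACA addrC.
have zw : z n @[n --> \oo] --> w.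
  rewrite -[w]addr0 -(subrr (K x)); apply: cvgD; first exact: Rncvg (cvg_cst w).
  have KR : K (Rn n x) @[n --> \oo] --> K x.
    apply: continuous_cvg; [exact: cK|exact: Rx].
  by apply: cvgB => //; exact: Rncvg.
have Dy' : D (y' n) @[n --> \oo] --> w - K x.
  have -> : (fun n => D (y' n)) = (fun n => z n - K (Rn n x)).
    by apply/funext => n; rewrite -zE addrK.
  by apply: cvgB => //; apply: continuous_cvg; [exact: cK|exact: Rx].
have -> : y = w + (w - K x).
  by rewrite addrA -mulr2n -scaler_nat scalerA divff ?pnatr_eq0// scale1r addrK.
apply: (@closed_pair_lim _ _ _ (fun n => Rn n x)
  (fun n => z n + D (y' n))) => //.
- exact: closed_closure.
- move=> n; apply: subset_closure.
  by exists (y' n), (z n); split=> //=; rewrite -zE.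
- exact: (cvgD zw Dy').
Qed.

End Anticommutator.

(** * The uniform boundedness principle *)

Section PointwiseLimit.
Variables (R : realType).
Let C : numFieldType := R[i]%C.
Variables (V : completeNormedModType C) (W : normedModType C).
Variable T : nat -> V -> W.
Hypothesis Tcont : forall n, continuous (T n).

(** Otherwise some T n is larger than any given k somewhere in any given ball,
    and by continuity on a smaller ball. This yields nested balls shrinking to
    a point at which the sequence is unbounded. *)
Lemma locally_uniformly_bounded :
  (forall x, exists M : nat, forall n, `|T n x| <= M%:R) ->
  exists x0 (r : C) (M : nat), 0 < r /\
    forall n y, `|x0 - y| < r -> `|T n y| <= M%:R.
Proof.
move=> Tpw; apply: contrapT => noball.
have unbd x (r : C) (k : nat) : 0 < r ->
    exists n y, `|x - y| < r /\ k%:R < `|T n y|.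
  move=> r0; apply: contrapT => bd; apply: noball.
  exists x, r, k; split=> // n y xy.
  apply: contrapT => /negP Tny; apply: bd; exists n, y; split=> //.
  by rewrite real_ltNge ?normr_real// realn.
have /choice [f fP] : forall kp : nat * (V * C), exists q : V * C, 0 < kp.2.2 ->
    [/\ 0 < q.2, q.2 < kp.1.+1%:R^-1, `|kp.2.1 - q.1| + q.2 < kp.2.2 &
      exists n, forall z, `|q.1 - z| < q.2 + q.2 -> kp.1%:R < `|T n z|].
  move=> [k [x r]] /=.
  have [r0|] := pselect (0 < r); last by exists (x, r).
  have [n [y [xy ky]]] := unbd x r k r0.
  have /nbhs_ballP [e /= e0 ye] : \forall z \near y, k%:R < `|T n z|.
    by apply: cvgr_norm_gt ky; exact: Tcont.
  near (0 : C)^'+ => s.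
  exists (y, s) => _; split => //=.
  - by rewrite addrC -ltrBrDr; near: s; apply: nbhs_right_lt; rewrite subr_gt0.
  - exists n => z yz; apply: ye; rewrite -ball_normE; apply: lt_le_trans yz _.
    rewrite [e]splitr lerD//.
    by near: s; apply: nbhs_right_le; rewrite divr_gt0.
    by near: s; apply: nbhs_right_le; rewrite divr_gt0.
pose fix p k := if k is k'.+1 then f (k', p k') else (0, 1) : V * C.
have p0 k : 0 < (p k).2 by elim: k => [|k /(fP (k, p k)) []] /=.
have pP k := fP (k, p k) (p0 k).
(* the ball around p m stays inside the one around p k *)
have nested k m : (k <= m)%N -> `|(p k).1 - (p m).1| + (p m).2 <= (p k).2.
  elim: m => [|m IH].
    by rewrite leqn0 => /eqP ->; rewrite subrr normr0 add0r.
  rewrite leq_eqVlt => /orP [/eqP <-|]; first by rewrite subrr normr0 add0r.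
  move=> /IH; apply: le_trans; have [_ _ /ltW /= step _] := pP m.
  apply: le_trans (_ : _ <= `|(p k).1 - (p m).1| +
    (`|(p m).1 - (f (m, p m)).1| + (f (m, p m)).2)) _.
    by rewrite addrA lerD2r -{1}(subrKA (p m).1) ler_normD.
  by rewrite lerD2l.
have [x px] : exists x : V, (p k).1 @[k --> \oo] --> x.
  apply: cauchy_seq_cvg => e e0.
  have [N _ /(_ N (leqnn N)) /=] :=
    @cvgr_dist_lt _ _ _ _ _ _ _ (@cvg_invSn R) _ e0.
  rewrite sub0r normrN ger0_norm ?invr_ge0 ?ler0n// => Ne.
  exists N.+1 => n Nn; apply: lt_trans Ne.
  have [_ + _ _] := pP N; apply: le_lt_trans.
  by apply: le_trans _ (nested _ _ Nn); rewrite lerDl ltW.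
have [M xM] := Tpw x.
have [_ _ _ [n /(_ x)]] := pP M; rewrite /= => big.
suff : M%:R < `|T n x| by move=> /lt_le_trans /(_ (xM n)); rewrite ltxx.
apply: big; rewrite -/(p M.+1).
have [N _ pN] := @cvgr_dist_lt _ _ _ _ _ _ _ px _ (p0 M.+1).
rewrite -(subrKA (p (maxn N M.+1)).1).
apply: (le_lt_trans (ler_normD _ _)); apply: ler_ltD.
  by apply: le_trans _ (nested _ _ (leq_maxr N M.+1)); rewrite lerDl ltW.
by rewrite distrC; apply: pN; rewrite /= leq_maxl.
Unshelve. all: by end_near. Qed.

(** A uniform bound for the T n on a ball passes to the limit T', and by
    linearity a bound on one ball is a bound near zero. *)
Lemma pointwise_limit_continuous (T' : V -> W) : linear T' ->
  (forall x, T n x @[n --> \oo] --> T' x) -> continuous T'.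
Proof.
move=> lT' TT'.
have [x0 [r [M [r0 TM]]]] : exists x0 (r : C) (M : nat), 0 < r /\
    forall n y, `|x0 - y| < r -> `|T n y| <= M%:R.
  apply: locally_uniformly_bounded => x.
  have : cvgn (T ^~ x) by apply/cvg_ex; exists (T' x); exact: TT'.
  move=> /cvg_seq_bounded /pinfty_ex_gt0 [_ /complex_gt0E [b _ ->] Tb].
  exists (Num.trunc b).+1 => n; apply: le_trans (Tb n _) _ => //.
  rewrite -(rmorph_nat (real_complex R)) lecR; apply: ltW; exact: truncnS_gt.
have T'M y : `|x0 - y| < r -> `|T' y| <= M.+1%:R.
  move=> xy; have [N _ /(_ N (leqnn N)) /= TN] :=
    @cvgr_dist_lt _ _ _ _ _ _ _ (TT' y) _ ltr01.
  rewrite -(subrK (T N y) (T' y)) -natr1; apply: (le_trans (ler_normD _ _)).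
  by rewrite [leLHS]addrC lerD// ?TM// ltW.
pose L : {linear V -> W} := HB.pack T' (GRing.isLinear.Build _ _ _ _ T' lT').
apply: (@bounded_linear_continuous _ _ _ L).
apply/ex_bound; exists (M.+1%:R + M.+1%:R); apply/nbhs_norm0P.
exists r => //= z zr.
have T'z : T' z = T' (x0 + z) - T' x0.
  by rewrite -[x0 + z]addrC -[z]scale1r lT' !scale1r addrK.
rewrite /= T'z; apply: (le_trans (ler_normB _ _)).
rewrite lerD// T'M// ?subrr ?normr0//.
by rewrite opprD addrA subrr sub0r normrN.
Qed.

End PointwiseLimit.

(** * Unitary operators and commutators *)

Section Unitary.
Variables (R : realType) (H : hilbertType R).
Implicit Types (x y z : H) (U : H -> H).

Lemma op_invK U x : unitary U -> U (op_inv U x) = x.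
Proof. by move=> [_ _ rU]; apply: pinvK; rewrite rU in_setT. Qed.

Lemma unitary_norm U x : unitary U -> `|U x| = `|x|.
Proof.
move=> [_ iU _]; apply/eqP; rewrite -(@eqrXn2 _ 2)//.
by rewrite -!inner_norm iU.
Qed.

Lemma op_invKV U x : unitary U -> op_inv U (U x) = x.
Proof.
move=> uU; have [lU _ _] := uU; apply: pinvKV; last by rewrite in_setT.
move=> u v _ _ uv; apply/eqP; rewrite -subr_eq0 -normr_eq0.
by rewrite -(unitary_norm _ uU) opB// uv subrr normr0.
Qed.

Lemma unitary_op_inv U : unitary U -> unitary (op_inv U).
Proof.
move=> uU; have [lU iU _] := uU; split=> [a x y|x y|].
- by rewrite -[RHS](op_invKV _ uU) lU !op_invK.
- by rewrite -iU !op_invK.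
- by apply/seteqP; split=> // x _; exists (U x); rewrite ?op_invKV.
Qed.

Lemma inner_op_inv U x y : unitary U -> inner (op_inv U x) y = inner x (U y).
Proof. by move=> uU; have [_ iU _] := uU; rewrite -iU op_invK. Qed.

Lemma unitary_bounded U : unitary U -> bounded_operator U.
Proof.
move=> uU; have [lU _ _] := uU; split=> // x.
apply/(@cvgrPdist_lt _ _ _ (nbhs x)) => e e0.
have : \forall y \near x, `|x - y| < e.
  by apply: (@cvgr_dist_lt _ _ _ (nbhs x) _ id).
by apply: filterS => y xy; rewrite -opB// unitary_norm.
Qed.

Lemma bounded_operator_iter U n : bounded_operator U ->
  bounded_operator (iter n U).
Proof.
move=> bU; elim: n => [|n IH]; last exact: bounded_operator_comp bU IH.
by split=> // x; exact: cvg_id.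
Qed.

End Unitary.

Section Commutator.
Variables (R : realType) (H : hilbertType R) (A : set (H * H)).
Hypothesis sA : self_adjoint A.
Implicit Types (x y z : H) (S T : H -> H).
Let C : numFieldType := R[i]%C.

(** The quadratic identity on the domain of A polarizes to a sesquilinear one,
    which says that (S x, S (A x) - T x) belongs to the graph of the adjoint
    of A, that is, of A. So S preserves the domain of A, and T = S A - A S
    there. *)
Lemma is_commutatorP S T : bounded_operator S ->
  is_commutator S A T <->
  bounded_operator T /\ forall x y, A (x, y) -> A (S x, S y - T x).
Proof.
move=> [lS cS]; split=> -[bT ST]; split=> //; have [lT cT] := bT.
- pose B (p q : H * H) :=
    inner p.1 (S q.2) - inner p.2 (S q.1) - inner p.1 (T q.1).
  have Bpp p : A p -> B p p = 0.
    by case: p => x y /ST; rewrite /B => ->; rewrite subrr.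
  have B0 x y u v : A (x, y) -> A (u, v) -> B (x, y) (u, v) = 0.
    move=> Axy Auv.
    have skew u' v' : A (u', v') -> B (x, y) (u', v') + B (u', v') (x, y) = 0.
      move=> Auv'; have := Bpp _ (graphD sA Axy Auv').
      have := Bpp _ Auv'; have := Bpp _ Axy.
      rewrite /B /= !(opD _ _ lS) !(opD _ _ lT) !(innerDl, innerDr) => ex eu e.
      apply/eqP; rewrite -e -[X in X == _]addr0 -ex -[X in X == _]addr0 -eu.
      by apply/eqP; ring.
    have /eqP : 'i * (B (x, y) (u, v) - B (u, v) (x, y)) = 0.
      rewrite -[RHS](skew _ _ (graphZ sA 'i Auv)) /B /=.
      by rewrite !(opZ _ _ lS) !(opZ _ _ lT) !(innerZl, innerZr) conjCi; ring.
    rewrite mulf_eq0 (negbTE (neq0Ci _)) /= subr_eq0 => /eqP e.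
    have /eqP := skew _ _ Auv; rewrite -e -mulr2n mulrn_eq0 /= => /eqP.
    by [].
  move=> u v Auv; apply: (self_adjointP sA) => x y Axy.
  have /eqP := B0 _ _ _ _ Axy Auv; rewrite /B /= subr_eq0 subr_eq => /eqP e.
  rewrite innerC [RHS]innerC; congr (_^*); rewrite innerBr e.
  by rewrite addrAC subrr add0r.
- move=> x y Axy; have := self_adjoint_sym sA Axy (ST _ _ Axy).
  by rewrite innerBr => /eqP; rewrite subr_eq addrC => /eqP ->; rewrite addrK.
Qed.

Lemma commutatorE S T : bounded_operator S -> is_commutator S A T ->
  commutator S A = T.
Proof.
move=> bS ST; apply: xget_unique => // T' ST'; apply/funext.
have /is_commutatorP-/(_ bS) [[_ cT] AT] := ST.
have /is_commutatorP-/(_ bS) [[_ cT'] AT'] := ST'.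
have [_ dA _] := sA; apply: (continuous_eq_dense dA) => // x [y Axy].
exact/oppr_inj/addrI/(graph_fun sA (AT' _ _ Axy) (AT _ _ Axy)).
Qed.

(** The derivative at 0 of h |-> <x, e^(-ihA) S e^(ihA) x> for x in the domain
    of A is <i A x, S x> + <x, S i A x>, by the product rule applied to
    <e^(ihA) x, S e^(ihA) x>. *)
Lemma commutator_derivative (W : R -> H -> H) S S' : exp_group A W ->
  bounded_operator S -> bounded_operator S' ->
  (forall x,
    (h%:C%C)^-1 *: (W (- h) (S (W h x)) - S x) @[h --> 0^'] --> S' x) ->
  is_commutator S A (fun x => - 'i *: S' x).
Proof.
move=> [uW W0 WD Wc AE] bS bS' SS'; have [lS cS] := bS.
split; first exact: bounded_operatorZ.
move=> x y; rewrite {1}AE /= => dW.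
have Wx : W h x @[h --> 0^'] --> x.
  rewrite -[X in _ --> X]W0; apply: cvg_within_filter; exact: Wc.
have SW : S (W h x) @[h --> 0^'] --> S x.
  by apply: continuous_cvg; [exact: cS|].
have SdW : S ((h%:C%C)^-1 *: (W h x - x)) @[h --> 0^'] --> S ('i *: y).
  by apply: continuous_cvg; [exact: cS|].
have quotE : (fun h : R =>
    inner x ((h%:C%C)^-1 *: (W (- h) (S (W h x)) - S x)) : C) =
  (fun h => inner ((h%:C%C)^-1 *: (W h x - x)) (S (W h x)) +
            inner x (S ((h%:C%C)^-1 *: (W h x - x)))).
  apply/funext => h; have [lW iW _] := uW h.
  have -> : inner x ((h%:C%C)^-1 *: (W (- h) (S (W h x)) - S x)) =
      (h%:C%C)^-1 * (inner (W h x) (S (W h x)) - inner x (S x)).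
    by rewrite innerZr innerBr -(iW x) -WD subrr W0.
  rewrite (opZ _ _ lS) (opB _ _ lS) innerZl innerZr innerBl innerBr.
  by rewrite fmorphV /= conj_real_complex; ring.
have E : inner x (S' x) = inner ('i *: y) (S x) + inner x (S ('i *: y)).
  have hC : hausdorff_space C by exact: norm_hausdorff.
  have lim1 : (inner x ((h%:C%C)^-1 *: (W (- h) (S (W h x)) - S x)) : C)
      @[h --> 0^'] --> (inner x (S' x) : C).
    exact: cvg_inner (cvg_cst x) (SS' x).
  apply: (cvg_unique hC lim1).
  rewrite /= quotE; apply: (@cvgD C C); first exact: cvg_inner.
  exact: cvg_inner (cvg_cst x) SdW.
rewrite innerZr E innerZl opZ// innerZr conjCi mulrDr !mulrA mulrNN.
by rewrite mulNr -expr2 sqrCi opprK mulN1r mul1r addrC.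
Qed.

(** The derivative at 0 exists at each vector by assumption; it is bounded as
    the pointwise limit of the difference quotients along h = 1 / (n + 1). *)
Lemma C1_commutator S : C1 A S -> exists T, is_commutator S A T.
Proof.
move=> [bS [W eW dS]].
have /choice [S' SS'] : forall x, exists S'x : H,
    (h%:C%C)^-1 *: (W (- h) (S (W h x)) - S x) @[h --> 0^'] --> S'x.
  move=> x; have [f' _ df] := dS x; exists (f' 0).
  have [_ W0 _ _ _] := eW.
  by move: (df 0); under eq_fun do rewrite add0r oppr0 !W0.
have [uW W0 WD Wc AE] := eW; have [lS cS] := bS.
pose Q (h : R) x := (h%:C%C)^-1 *: (W (- h) (S (W h x)) - S x).
have bQ h : bounded_operator (Q h).
  apply: (@bounded_operatorZ _ _ (h%:C%C)^-1
    (fun x => W (- h) (S (W h x)) - S x)).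
  apply: (@bounded_operatorD _ _ (fun x => W (- h) (S (W h x)))
    (fun x => - S x)).
    apply: (@bounded_operator_comp _ _ (W (- h)) (fun x => S (W h x))).
      exact: unitary_bounded.
    by apply: bounded_operator_comp => //; exact: unitary_bounded.
  exact: bounded_operatorN.
have lS' : linear S'.
  move=> a x y; apply: (cvg_unique (@hilbert_hausdorff R H) (SS' _)).
  have -> : (fun h : R =>
      (h%:C%C)^-1 *: (W (- h) (S (W h (a *: x + y))) - S (a *: x + y))) =
      (fun h => a *: Q h x + Q h y).
    by apply/funext => h; have [lQ _] := bQ h; exact: lQ.
  by apply: cvgD; [apply: cvgZl_tmp|]; exact: SS'.
have bS' : bounded_operator S'.
  split=> //.
  apply: (@pointwise_limit_continuous _ _ _ (fun n => Q n.+1%:R^-1)) => //.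
    by move=> n; have [] := bQ n.+1%:R^-1.
  move=> x; apply: (cvg_comp (fun n => n.+1%:R^-1) (Q ^~ x) _ (SS' x)).
  move=> P P0; have [M _ PM] := @cvg_harmonic R _ P0; exists M => // n Mn.
  by apply: (PM n Mn); rewrite /harmonic /= invr_eq0 pnatr_eq0.
by exists (fun x => - 'i *: S' x); exact: commutator_derivative eW bS bS' SS'.
Qed.

End Commutator.

(** * Conjugating A by powers of U *)

Section Conjugation.
Variables (R : realType) (H : hilbertType R) (A : set (H * H)) (U : H -> H).
Hypotheses (sA : self_adjoint A) (uU : unitary U).
Implicit Types (x y z : H) (S T K D : H -> H).
Let C : numFieldType := R[i]%C.
Local Notation Ui := (op_inv U).

(** K is the bounded operator A - U^n A U^-n; the last two clauses state this
    relation from both sides, so that U^n and U^-n both preserve the domain of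
    A. *)
Definition conj_defect (n : nat) K : Prop :=
  [/\ bounded_operator K, symmetric_op K,
      forall x y, A (x, y) -> A (iter n U x, iter n U y + K (iter n U x))
    & forall x y, A (x, y) -> A (iter n Ui x, iter n Ui (y - K x))].

Lemma iter_op_invK n x : iter n U (iter n Ui x) = x.
Proof. by elim: n x => // n IH x; rewrite iterSr iterS op_invK. Qed.

(** The inclusion of the domain of A in its image by U comes from
    self-adjointness: for x in the domain of A, the functional u |-> <U^-1 x,
    A u> is computed by moving U across the scalar product, as A U u = U A u -
    T u is already known. *)
Lemma conj_defect1 T : is_commutator U A T ->
  conj_defect 1 (fun x => - T (Ui x)).
Proof.
have bU := unitary_bounded uU; have bUi := unitary_bounded (unitary_op_inv uU).
move=> /is_commutatorP-/(_ sA bU) [bT AT]; have [lU iU rU] := uU.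
have [lUi _ _] := unitary_op_inv uU.
have UT x y : inner (T x) (U y) = inner (U x) (T y).
  have [[_ cT] [_ cU] [_ dA _]] := And3 bT bU sA.
  apply: (inner_eq_dense (f1 := T) (g1 := U) (f2 := U) (g2 := T) dA) => //.
  move=> u v [u' Au] [v' Av].
  have := self_adjoint_sym sA (AT _ _ Au) (AT _ _ Av).
  rewrite innerBl innerBr !iU (self_adjoint_sym sA Au Av).
  by move/addrI/oppr_inj.
have Ksym x y : inner (T (Ui x)) y = inner x (T (Ui y)).
  by rewrite -{1}[y](op_invK _ uU) UT op_invK.
split=> [|x y|x y Axy|x y Axy] /=.
- exact: bounded_operatorN (bounded_operator_comp bT bUi).
- by rewrite innerNl innerNr Ksym.
- by rewrite op_invKV//; exact: AT.
- apply: (self_adjointP sA) => u v Auv.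
  rewrite inner_op_inv// inner_op_inv// opprK innerDl Ksym op_invKV//.
  have := self_adjoint_sym sA Axy (AT _ _ Auv).
  by rewrite innerBr => <-; rewrite subrK.
Qed.

(** The sum of the U^k K U^-k over k < n, in the recursive form that follows
    from K_(n+1) = K_1 + U K_n U^-1. *)
Fixpoint iter_defect K n x : H :=
  if n is n'.+1 then K x + U (iter_defect K n' (Ui x)) else 0.

Lemma conj_defect_iter K n : conj_defect 1 K -> conj_defect n (iter_defect K n).
Proof.
move=> [bK sK AK AKi]; have [lU iU rU] := uU.
have bU := unitary_bounded uU; have bUi := unitary_bounded (unitary_op_inv uU).
have [lUi _ _] := unitary_op_inv uU.
elim: n => [|n [bn sn An Ani]].
  split=> [|x y|x y|x y] /=; rewrite ?addr0 ?subr0//.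
    exact: bounded_operator0.
  by rewrite inner0l inner0r.
split=> [|x y|x y Axy|x y Axy] /=.
- by apply: bounded_operatorD => //; do 2!apply: bounded_operator_comp => //.
- rewrite innerDl innerDr sK -(inner_op_inv _ _ uU) -sn; congr (_ + _).
  by rewrite -[RHS]iU op_invK.
- have := AK _ _ (An _ _ Axy); rewrite /= (opD _ _ lU) op_invKV//.
  by rewrite -addrA [X in _ + X]addrC.
- have /= := Ani _ _ (AKi _ _ Axy).
  by rewrite -!iterS !iterSr opprD addrA (opB (y - K x) _ lUi) op_invKV.
Qed.

Lemma conj_defect_commutator n K : conj_defect n K ->
  is_commutator (iter n U) A (fun x => - K (iter n U x)).
Proof.
move=> [bK sK AK _]; have bUn := bounded_operator_iter n (unitary_bounded uU).
apply/(is_commutatorP sA _ bUn); split=> [|x y Axy].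
  exact: bounded_operatorN (bounded_operator_comp bK bUn).
by rewrite opprK; exact: AK.
Qed.

Lemma commutator_meanE n K x : conj_defect n K ->
  commutator_mean A U n x = n%:R^-1 *: K x.
Proof.
move=> KP; have bUn := bounded_operator_iter n (unitary_bounded uU).
rewrite /commutator_mean /commutator_l.
by rewrite (commutatorE sA bUn (conj_defect_commutator KP)) opprK iter_op_invK.
Qed.

Section MeanLimit.
Variables (K D : H -> H).
Hypothesis KP : conj_defect 1 K.
Hypothesis D_lim : forall x, commutator_mean A U N x @[N --> \oo] --> D x.

Let Dlim x : N%:R^-1 *: iter_defect K N x @[N --> \oo] --> D x.
Proof.
have := @D_lim x; have -> // : (fun N => commutator_mean A U N x) =
   (fun N => N%:R^-1 *: iter_defect K N x).
by apply/funext => N; rewrite (commutator_meanE _ (conj_defect_iter N KP)).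
Qed.

Lemma mean_limit_symmetric : symmetric_op D.
Proof.
move=> x y.
have hC : hausdorff_space C by exact: norm_hausdorff.
have lim1 : (inner (N%:R^-1 *: iter_defect K N x) y : C) @[N --> \oo] -->
    (inner (D x) y : C).
  exact: cvg_inner (@Dlim x) (cvg_cst y).
apply: (cvg_unique hC lim1).
have -> : (fun N => inner (N%:R^-1 *: iter_defect K N x) y) =
    (fun N => inner x (N%:R^-1 *: iter_defect K N y)).
  apply/funext => N; have [_ sK _ _] := conj_defect_iter N KP.
  by rewrite innerZl innerZr fmorphV /= conjC_nat sK.
exact: cvg_inner (cvg_cst x) (@Dlim y).
Qed.

(** Evaluated at U x, the recursion reads K_(N+1) U x = K_1 U x + U K_N x.
    Divided by N + 1, the left side tends to D U x, the first term to 0 and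
    the second one to U D x, since K_N / (N + 1) = (1 - 1 / (N + 1)) (K_N /
    N). *)
Lemma mean_limit_commutes x : D (U x) = U (D x).
Proof.
have [lU cU] := unitary_bounded uU.
have := @Dlim (U x); rewrite -cvg_shiftS => lim1.
apply: (cvg_unique (@hilbert_hausdorff R H) lim1).
have inv1 : (1 - N.+1%:R^-1 : C) @[N --> \oo] --> (1 - 0 : C).
  by apply: (@cvgB C C); [exact: cvg_cst|exact: cvg_invSn].
have -> : (fun N => N.+1%:R^-1 *: iter_defect K N.+1 (U x)) =
   (fun N => N.+1%:R^-1 *: K (U x)
             + U ((1 - N.+1%:R^-1 : C) *: (N%:R^-1 *: iter_defect K N x))).
  apply/funext => N /=; rewrite op_invKV// scalerDr; congr (_ + _).
  rewrite (opZ _ _ lU) (opZ _ _ lU) scalerA.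
  (* for N = 0 the inverse of N is 0, and so is the zeroth defect *)
  case: N => [|N]; first by rewrite /= (op0 lU) !scaler0.
  congr (_ *: _); apply: (@mulfI _ N.+2%:R); first by rewrite pnatr_eq0.
  rewrite divff ?pnatr_eq0// mulrA mulrBr divff ?pnatr_eq0// mulr1.
  by rewrite -[X in X - 1]natr1 addrK divff ?pnatr_eq0.
rewrite -[U (D x)]add0r; apply: cvgD.
  by rewrite -(scale0r (K (U x))); apply: cvgZr_tmp; exact: cvg_invSn.
apply: continuous_cvg; first exact: cU.
by rewrite -[D x]scale1r -[X in X *: D x](subr0 1); exact: cvgZ.
Qed.

Lemma mean_limit_commutes_inv n x : D (iter n Ui x) = iter n Ui (D x).
Proof.
elim: n => //= n <-.
by rewrite -[LHS](op_invKV _ uU) -mean_limit_commutes op_invK.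
Qed.

End MeanLimit.

(** * The average of the conjugates of the anticommutator *)
Section Average.
Variables (K D : H -> H).
Hypothesis KP : conj_defect 1 K.
Hypothesis bD : bounded_operator D.
Hypothesis sD : symmetric_op D.
Hypothesis DU : forall n x, D (iter n Ui x) = iter n Ui (D x).

Definition defect_anticomm n x := iter_defect K n (D x) + D (iter_defect K n x).

Lemma bounded_defect_anticomm n : bounded_operator (defect_anticomm n).
Proof.
have [bK _ _ _] := conj_defect_iter n KP.
by apply: bounded_operatorD; exact: bounded_operator_comp.
Qed.

Lemma symmetric_defect_anticomm n : symmetric_op (defect_anticomm n).
Proof.
have [_ sK _ _] := conj_defect_iter n KP.
by move=> x y; rewrite innerDl innerDr sK !sD sK addrC.
Qed.

(** The map (x, y) |-> (U^-n x, U^-n (y - B_n x)) with B_n = K_n D + D K_n is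
    continuous and preserves the graph of A D + D A on the domain of A, hence
    its closure. *)
Lemma anticommutator_conj n x y : anticommutator A D (x, y) ->
  anticommutator A D (iter n Ui x, iter n Ui (y - defect_anticomm n x)).
Proof.
have bUin := bounded_operator_iter n (unitary_bounded (unitary_op_inv uU)).
have [lUin cUin] := bUin; have [_ cB] := bounded_defect_anticomm n.
have [bK _ _ AK] := conj_defect_iter n KP; have [lD _] := bD.
pose f (p : H * H) := (iter n Ui p.1, iter n Ui (p.2 - defect_anticomm n p.1)).
have cf : continuous f.
  move=> p; apply: cvg_pair.
    by apply: continuous_cvg; [exact: cUin|exact: cvg_fst].
  apply: continuous_cvg; first exact: cUin.
  apply: cvgB; first exact: cvg_snd.
  by apply: continuous_cvg; [exact: cB|exact: cvg_fst].
rewrite /anticommutator; set T0 := [set p | _].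
suff fT : T0 `<=` f @^-1` T0 by move/(closure_preimage_sub cf fT).
move=> [u v] [y' [z' [/= Ay Az ->]]].
exists (iter n Ui (y' - iter_defect K n u)).
exists (iter n Ui (z' - iter_defect K n (D u))).
split=> /=; [exact: AK|by rewrite DU; exact: AK|].
rewrite DU -(opD _ _ lUin) (opB _ _ lD) /defect_anticomm.
by rewrite opprD addrACA.
Qed.

Hypothesis sAD : self_adjoint (anticommutator A D).
Variable N : nat.
Hypothesis N_gt0 : (0 < N)%N.

Let B x := (N%:R^-1 : C) *: \sum_(n < N) defect_anticomm n x.

(** The values on U^-n x entering the average are unique because A_D is
    single-valued, and they are those given by [anticommutator_conj]. *)
Lemma averageE : average (anticommutator A D) U N =
  [set p | anticommutator A D (p.1, p.2 + B p.1)].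
Proof.
have mean x y :
    N%:R^-1 *: \sum_(n < N) iter n U (iter n Ui (y - defect_anticomm n x)) =
    y - B x.
  under eq_bigr do rewrite iter_op_invK.
  rewrite sumrB scalerBr sumr_const card_ord -(scaler_nat N y) scalerA.
  rewrite mulVf ?scale1r//.
  by rewrite pnatr_eq0 -lt0n.
apply/seteqP; split=> [[x z] [[y Dxy] [v [Dv zE]]]|[x z] /= Dxz] /=.
  rewrite /= in Dxy Dv zE; rewrite zE.
  have -> : \sum_(n < N) iter n U (v n) =
      \sum_(n < N) iter n U (iter n Ui (y - defect_anticomm n x)).
    apply: eq_bigr => n _; congr (iter _ _ _).
    exact: (graph_fun sAD (Dv n (ltn_ord n)) (@anticommutator_conj n _ _ Dxy)).
  by rewrite mean subrK.
split; first by exists (z + B x).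
exists (fun n => iter n Ui (z + B x - defect_anticomm n x)); split.
  by move=> n _; exact: anticommutator_conj.
by rewrite mean addrK.
Qed.

Let bB : bounded_operator B.
Proof.
apply: bounded_operatorZ; apply: bounded_operator_sum.
exact: bounded_defect_anticomm.
Qed.

Let sB : symmetric_op B.
Proof.
have sS := symmetric_op_sum N symmetric_defect_anticomm.
by move=> x y; rewrite innerZl innerZr fmorphV /= conjC_nat sS.
Qed.

Lemma average_dom : graph_dom (average (anticommutator A D) U N) =
  graph_dom (anticommutator A D).
Proof.
rewrite averageE; apply/seteqP; split=> x [y /= Dxy].
  by exists (y + B x).
by exists (y - B x); rewrite /= subrK.
Qed.

Lemma average_self_adjoint : self_adjoint (average (anticommutator A D) U N).
Proof. by rewrite averageE; exact: self_adjoint_perturbation. Qed.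

(** The shear (x, y) |-> (x, y + B x) is a homeomorphism which carries the
    graph of the average to that of A_D without moving the first component, so
    it carries closures to closures and cores to cores. *)
Lemma average_core : graph_dom A `<=` graph_dom (anticommutator A D) ->
  is_core (graph_dom A) (average (anticommutator A D) U N).
Proof.
move=> AD; split; first by rewrite average_dom.
have [_ cB] := bB.
pose f (p : H * H) := (p.1, p.2 + B p.1).
pose g (p : H * H) := (p.1, p.2 - B p.1).
have cf : continuous f.
  move=> p; apply: cvg_pair; first exact: cvg_fst.
  apply: cvgD; first exact: cvg_snd.
  by apply: continuous_cvg; [exact: cB|exact: cvg_fst].
have cg : continuous g.
  move=> p; apply: cvg_pair; first exact: cvg_fst.
  apply: cvgB; first exact: cvg_snd.
  by apply: continuous_cvg; [exact: cB|exact: cvg_fst].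
have fK : cancel f g by move=> [x y]; rewrite /f /g /= addrK.
have gK : cancel g f by move=> [x y]; rewrite /f /g /= subrK.
rewrite averageE.
transitivity
  (f @^-1` closure [set p | anticommutator A D p /\ graph_dom A p.1]).
  exact: (closure_preimage_homeo _ cf cg fK gK).
congr (f @^-1` _); apply/seteqP; split.
  rewrite closureE; apply: smallest_sub; first exact: self_adjoint_closed.
  by move=> p [].
apply: closureS => p Tp; split; first exact: subset_closure.
by have [y [_ [Ay _ _]]] := Tp; exists y.
Qed.

End Average.

End Conjugation.

Unset Implicit Arguments.
Set Strict Implicit.

(** * Self-adjointness of the averages *)

Theorem proposition2p5 (R : realType) (H : hilbertType R)
    (U : H -> H) (A : set (H * H)) (D : H -> H)
    (unitaryU : unitary U)
    (saA : self_adjoint A)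
    (U_C1 : C1 A U)
    (D_bounded : bounded_operator D)
    (D_lim : forall x, commutator_mean A U N x @[N --> \oo] --> D x)
    (D_C1 : C1 A D)
    (N : nat) (N_ge1 : (1 <= N)%N) :
  [/\ graph_dom (average (anticommutator A D) U N)
        = graph_dom (anticommutator A D),
      self_adjoint (average (anticommutator A D) U N)
    & is_core (graph_dom A) (average (anticommutator A D) U N)].
Proof.
have [TU TUP] := C1_commutator U_C1.
have [TD TDP] := C1_commutator D_C1.
have KP := conj_defect1 saA unitaryU TUP.
have sD := mean_limit_symmetric saA unitaryU KP D_lim.
have DU := mean_limit_commutes_inv saA unitaryU KP D_lim.
have /is_commutatorP-/(_ saA D_bounded) [bTD ADT] := TDP.
have sAD : self_adjoint (anticommutator A D).
  apply: (anticommutator_self_adjoint saA D_bounded sD _ ADT).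
  exact: bounded_operatorN.
split.
- exact: (average_dom unitaryU KP D_bounded DU sAD N_ge1).
- exact: (average_self_adjoint unitaryU KP D_bounded sD DU sAD N_ge1).
- apply: (average_core unitaryU KP D_bounded DU sAD N_ge1).
  move=> x; exact: (anticommutator_dom ADT).
Qed.
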